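(* Let $L\subseteq\mathbb{S}^N$ be an affine subspace with $L\cap\mathbb{S}^N_+\neq\varnothing$. Let $G_1,\dots,G_p\in\mathbb{S}^N_+$ be nonzero matrices, let $$\mathcal K=\operatorname{cone}\{G_i\mid i=1,\dots,p\},\qquad \mathcal K^*=\{Y\in\mathbb{S}^N\mid\langle G_i,Y\rangle\ge 0,\ i=1,\dots,p\},$$ and let $$\mathcal J=\{i\in\{1,\dots,p\}\mid \langle G_i,Y\rangle=0\ \text{ for every } Y\in L\cap\mathcal K^*\}.$$ If $W\in\operatorname{ri}(L^\perp\cap\mathcal K)$, then $$\mathbb{S}^N_+\cap W^\perp=\{Y\succeq 0\mid YG_i=0\ \text{ for every } i\in\mathcal J\}.$$
   Context: $\mathbb{S}^N$ is the space of real symmetric $N\times N$ matrices with inner product $\langle X,Y\rangle=\operatorname{tr}(XY)$, and $\mathbb{S}^N_+$ is the positive semidefinite cone. $\operatorname{cone}$ denotes the set of nonnegative linear combinations. For a set $S\subseteq\mathbb{S}^N$ (including an affine subspace), $S^\perp=\{Z\in\mathbb{S}^N\mid\langle Z,X\rangle=0\ \forall X\in S\}$; for a single matrix, $W^\perp=\{W\}^\perp$. $\operatorname{ri}$ denotes relative interior. *)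

(* Defs.v *)
From HB Require Import structures.
From mathcomp Require Import all_boot all_order all_algebra.
From mathcomp Require Import all_classical all_reals all_analysis.

Set Implicit Arguments.
Unset Strict Implicit.
Unset Printing Implicit Defensive.

Import Order.TTheory GRing.Theory Num.Theory.
Import numFieldNormedType.Exports.

Local Open Scope classical_set_scope.
Local Open Scope ring_scope.

Definition symmx (R : realType) (N : nat) : set 'M[R]_N :=
  [set X | X \is symmetricmx].

Definition psdmx (R : realType) (N : nat) : set 'M[R]_N :=
  [set X | symmx X /\ forall v : 'cV[R]_N, 0 <= (v^T *m X *m v) 0 0].

Definition mxinner (R : realType) (N : nat) (X Y : 'M[R]_N) : R :=
  \tr (X *m Y).

(* The orthogonal complement is taken inside the symmetric matrices, and S is
   not translated to the origin when it is affine. *)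
Definition orthmx (R : realType) (N : nat) (S : set 'M[R]_N) : set 'M[R]_N :=
  [set Z | symmx Z /\ forall X, S X -> mxinner Z X = 0].

(* Closed under lines; in particular set0 is affine. *)
Definition affine (R : realType) (V : lmodType R) (A : set V) : Prop :=
  forall (x y : V) (t : R), A x -> A y -> A ((1 - t) *: x + t *: y).

Definition affine_hull (R : realType) (V : lmodType R) (A : set V) : set V :=
  smallest (@affine R V) A.

Definition cone (R : realType) (V : lmodType R) (A : set V) : set V :=
  [set x | exists (k : nat) (c : 'I_k -> R) (a : 'I_k -> V),
     (forall i, 0 <= c i /\ A (a i)) /\ x = \sum_(i < k) c i *: a i].

(* Interior of A in the subspace topology of its affine hull. *)
Definition relint (R : realType) (N : nat) (A : set 'M[R]_N) : set 'M[R]_N :=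
  [set X | A X /\ within (affine_hull A) (nbhs X) A].

(* Main.v *)
(* By Farkas' lemma on the linear span of L, an index i lies in J exactly when
   some element of the linear space L^perp is a nonnegative combination of
   G_1, ..., G_p with a positive coefficient on G_i.  As W is relatively
   interior to L^perp /\ K, the segment from any such element to W can be
   prolonged past W inside K, so a psd matrix orthogonal to W is orthogonal to
   that element, hence to G_i; for psd matrices, <G_i, Y> = 0 means Y G_i = 0.
   Conversely, every G_i occurring in W with a positive coefficient has i in J.
*)
Require Import Defs.
From HB Require Import structures.
From mathcomp Require Import all_boot all_order all_algebra.
From mathcomp Require Import all_classical all_reals all_analysis.
From mathcomp Require Import ring lra.

Import Order.TTheory GRing.Theory Num.Theory.
Import numFieldNormedType.Exports.

Local Open Scope classical_set_scope.
Local Open Scope ring_scope.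

(** * Positive semidefinite matrices and their quadratic forms *)

Lemma symmxP (R : realType) (N : nat) (X : 'M[R]_N) : symmx X <-> X^T = X.
Proof.
rewrite /symmx /=; split.
  by move/is_hermitianmxP; rewrite expr0 scale1r map_mx_id // => <-.
by move=> h; apply/is_hermitianmxP; rewrite expr0 scale1r map_mx_id // h.
Qed.

Lemma psd_cauchy_schwarz (R : realType) (N : nat) (A : 'M[R]_N)
    (x y : 'cV[R]_N) :
  psdmx A -> (x^T *m A *m y) 0 0 ^+ 2
             <= (x^T *m A *m x) 0 0 * (y^T *m A *m y) 0 0.
Proof.
case=> /symmxP sA pA.
set b := (x^T *m A *m y) 0 0; set a := (x^T *m A *m x) 0 0.
set c := (y^T *m A *m y) 0 0.
have yx : (y^T *m A *m x) 0 0 = b.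
  have -> : y^T *m A *m x = (x^T *m A *m y)^T.
    by rewrite !trmx_mul trmxK sA mulmxA.
  by rewrite [LHS]mxE.
have q s t : 0 <= s ^+ 2 * a + 2 * s * t * b + t ^+ 2 * c.
  have := pA (s *: x + t *: y).
  have -> : (s *: x + t *: y)^T = s *: x^T + t *: y^T.
    by rewrite linearD !linearZ.
  rewrite !(mulmxDl, mulmxDr) -!(scalemxAl, scalemxAr).
  have E (B C D F : 'M[R]_1) :
      (s *: (s *: B) + t *: (s *: C) + (s *: (t *: D) + t *: (t *: F))) 0 0 =
      s ^+ 2 * B 0 0 + s * t * (C 0 0 + D 0 0) + t ^+ 2 * F 0 0.
    by rewrite !mxE; ring.
  rewrite E yx -/a -/b -/c; congr (_ <= _); ring.
have a0 : 0 <= a by exact: pA.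
have c0 : 0 <= c by exact: pA.
(* For [c = 0], the value [- b ^+ 2 * (a + 2)] of the form at [(- b, a + 1)] forces [b = 0].
   Otherwise [(c, - b)] gives [c * (a * c - b ^+ 2)]. *)
have [c1|c1] := eqVneq c 0.
  have := q (- b) (a + 1); have := q b (- (a + 1)); rewrite c1; nra.
have := q c (- b); have : 0 < c by rewrite lt_neqAle eq_sym c1.
nra.
Qed.

Lemma psd_form_eq0 (R : realType) (N : nat) (A : 'M[R]_N) (x : 'cV[R]_N) :
  psdmx A -> (x^T *m A *m x) 0 0 = 0 -> A *m x = 0.
Proof.
move=> pA x0; apply/matrixP => i j; rewrite ord1 [RHS]mxE.
have := @psd_cauchy_schwarz _ _ A (delta_mx i 0) x pA.
rewrite x0 mulr0 trmx_delta -mulmxA -rowE mxE => h.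
have : (A *m x) i 0 ^+ 2 == 0 by rewrite eq_le h sqr_ge0.
by rewrite sqrf_eq0 => /eqP.
Qed.

Lemma psd_diag_ge0 (R : realType) (N : nat) (A : 'M[R]_N) (i : 'I_N) :
  psdmx A -> 0 <= A i i.
Proof.
by case=> _ /(_ (delta_mx i 0)); rewrite trmx_delta -rowE -colE !mxE.
Qed.

Lemma psd_diag_eq0 (R : realType) (N : nat) (A : 'M[R]_N) (i j : 'I_N) :
  psdmx A -> A i i = 0 -> A j i = 0.
Proof.
move=> pA Aii; have := @psd_form_eq0 _ _ A (delta_mx i 0) pA.
rewrite trmx_delta -rowE -!colE !mxE => /(_ Aii) /colP/(_ j).
by rewrite !mxE.
Qed.

(** The form of this Schur complement at [v] is nonnegative by Cauchy-Schwarz for [v] and the [k]-th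
    basis vector. *)
Lemma psd_schur (R : realType) (N : nat) (A : 'M[R]_N) (k : 'I_N) :
  psdmx A -> 0 < A k k ->
  psdmx (A - (A k k)^-1 *: (col k A *m (col k A)^T)).
Proof.
move=> pA Ak; have [/symmxP sA _] := pA; split.
  by apply/symmxP; rewrite linearB linearZ /= trmx_mul trmxK sA.
move=> v; have := @psd_cauchy_schwarz _ _ A (delta_mx k 0) v pA.
have -> : (delta_mx k (0 : 'I_1))^T *m A = (col k A)^T.
  by rewrite trmx_delta -rowE tr_col sA.
have -> : ((col k A)^T *m delta_mx k (0 : 'I_1)) 0 0 = A k k.
  by rewrite -colE !mxE.
rewrite mulmxBr mulmxBl -scalemxAr -scalemxAl !mulmxA.
have -> : v^T *m col k A *m (col k A)^T *m v =
    ((col k A)^T *m v)^T *m ((col k A)^T *m v).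
  by rewrite trmx_mul trmxK !mulmxA.
have E (a : R) (B C : 'M[R]_1) :
    (B - a *: (C^T *m C)) 0 0 = B 0 0 - a * C 0 0 ^+ 2.
  by rewrite !mxE big_ord1 mxE expr2.
rewrite E => h.
by rewrite subr_ge0 mulrC ler_pdivrMr // mulrC.
Qed.

(** Induction on the number of nonzero diagonal entries: a Schur step at [k] clears the [k]-th one
    and creates no other. A psd matrix with zero diagonal is zero. *)
Lemma psd_sum_rank1 (R : realType) (N : nat) (A : 'M[R]_N) :
  psdmx A -> exists s : seq 'cV[R]_N, A = \sum_(v <- s) v *m v^T.
Proof.
have [n] := ubnP #|[pred i | A i i != 0]|.
elim: n A => // n IH A; rewrite ltnS => leA pA.
have [k Ak|A0] := pickP [pred i | A i i != 0]; last first.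
  exists [::]; rewrite big_nil; apply/matrixP => i j; rewrite [RHS]mxE.
  by apply: psd_diag_eq0 pA _; move/negbFE: (A0 j) => /eqP.
have Ak0 : 0 < A k k.
  by move: Ak => /= Ak; rewrite lt_neqAle eq_sym Ak psd_diag_ge0.
have pB := psd_schur R N A k pA Ak0.
set B := A - _ in pB.
have BE i : B i i = A i i - (A k k)^-1 * A i k ^+ 2.
  by rewrite !mxE big_ord1 !mxE expr2.
have [|s sE] := IH B _ pB.
  apply: leq_trans leA; apply: proper_card; apply/properP; split.
    apply/fintype.subsetP => i; rewrite !inE BE; apply: contra_neq => Ai.
    have [/symmxP sA _] := pA.
    have Aik : A i k = 0 by rewrite -sA mxE; exact: psd_diag_eq0 pA Ai.
    by rewrite Ai Aik expr0n /= mulr0 subr0.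
  by exists k; rewrite !inE // BE expr2 mulKf // subrr negbK eqxx.
exists (Num.sqrt (A k k)^-1 *: col k A :: s); rewrite big_cons -sE /B.
rewrite linearZ /= -scalemxAl -scalemxAr scalerA -expr2 sqr_sqrtr.
  by rewrite addrC subrK.
by rewrite invr_ge0 ltW.
Qed.

(** * The trace inner product on psd matrices *)

Lemma mxinnerC (R : realType) (N : nat) (X Y : 'M[R]_N) :
  mxinner X Y = mxinner Y X.
Proof. exact: mxtrace_mulC. Qed.

Lemma mxinnerDl (R : realType) (N : nat) (X X' Y : 'M[R]_N) :
  mxinner (X + X') Y = mxinner X Y + mxinner X' Y.
Proof. by rewrite /mxinner mulmxDl mxtraceD. Qed.

Lemma mxinnerDr (R : realType) (N : nat) (X Y Y' : 'M[R]_N) :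
  mxinner X (Y + Y') = mxinner X Y + mxinner X Y'.
Proof. by rewrite /mxinner mulmxDr mxtraceD. Qed.

Lemma mxinnerZl (R : realType) (N : nat) (a : R) (X Y : 'M[R]_N) :
  mxinner (a *: X) Y = a * mxinner X Y.
Proof. by rewrite /mxinner -scalemxAl mxtraceZ. Qed.

Lemma mxinnerZr (R : realType) (N : nat) (a : R) (X Y : 'M[R]_N) :
  mxinner X (a *: Y) = a * mxinner X Y.
Proof. by rewrite /mxinner -scalemxAr mxtraceZ. Qed.

Lemma mxinner_suml (R : realType) (N : nat) (I : Type) (r : seq I)
    (F : I -> 'M[R]_N) (Y : 'M[R]_N) :
  mxinner (\sum_(i <- r) F i) Y = \sum_(i <- r) mxinner (F i) Y.
Proof. by rewrite /mxinner mulmx_suml raddf_sum. Qed.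

Lemma mxinner_rank1 (R : realType) (N : nat) (v : 'cV[R]_N) (Y : 'M[R]_N) :
  mxinner (v *m v^T) Y = (v^T *m Y *m v) 0 0.
Proof. by rewrite /mxinner -mulmxA mxtrace_mulC /mxtrace big_ord1. Qed.

Lemma mxinner_psd_ge0 (R : realType) (N : nat) (X Y : 'M[R]_N) :
  psdmx X -> psdmx Y -> 0 <= mxinner X Y.
Proof.
move=> /psd_sum_rank1 [s ->] [_ pY]; rewrite mxinner_suml.
by apply: sumr_ge0 => v _; rewrite mxinner_rank1.
Qed.

(** With [X] a sum of terms [v *m v^T], the inner product is a sum of nonnegative values of the form
    of [Y]; all of them vanish, so [Y] kills every [v]. *)
Lemma mxinner_psd_eq0 (R : realType) (N : nat) (X Y : 'M[R]_N) :
  psdmx X -> psdmx Y -> mxinner X Y = 0 -> Y *m X = 0.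
Proof.
move=> /psd_sum_rank1 [s ->] pY; rewrite mxinner_suml => /eqP.
rewrite psumr_eq0 => [/allP h|v _]; last first.
  by rewrite mxinner_rank1; case: pY => _; apply.
rewrite mulmx_sumr big_seq big1 // => v /h /=; rewrite mxinner_rank1 => /eqP.
by move/(psd_form_eq0 R N Y v pY) => Yv; rewrite mulmxA Yv mul0mx.
Qed.

(** * Farkas' lemma on a linear subspace *)

(** Induction on the number of constraints. Either the first one is redundant and gets coefficient
    0, or some [x] violates it alone while [f x < 0], and projecting along [x] eliminates it. *)
Lemma farkas (R : realFieldType) (V : lmodType R) (M : set V) (m : nat)
    (g : 'I_m -> V -> R) (f : V -> R) :
  M 0 -> (forall a u v, M u -> M v -> M (a *: u + v)) ->
  (forall j, scalar (g j)) -> scalar f ->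
  (forall u, M u -> (forall j, 0 <= g j u) -> 0 <= f u) ->
  exists2 c : 'I_m -> R, forall j, 0 <= c j &
    forall u, M u -> f u = \sum_j c j * g j u.
Proof.
move=> M0 linM.
have scal0 (h : V -> R) : scalar h -> h 0 = 0.
  by move=> lh; have := lh (-1) 0 0; rewrite scaler0 addr0; lra.
have scalZ (h : V -> R) a u : scalar h -> h (a *: u) = a * h u.
  by move=> lh; have := lh a u 0; rewrite (scal0 h) // !addr0.
elim: m g f => [|m IH] g f lg lf hf.
  (* Without constraints, [f] is nonnegative at both [u] and [- u], hence zero. *)
  exists (fun _ => 0) => // u Mu; rewrite big_ord0.
  have Mu' : M ((-1) *: u) by rewrite -[X in M X]addr0; exact: linM.
  have := hf _ Mu'; rewrite scalZ // mulN1r oppr_ge0 => fu.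
  by apply/le_anti; rewrite hf ?fu // => -[].
have [hf'|] := pselect (forall u, M u ->
    (forall j, 0 <= g (lift ord0 j) u) -> 0 <= f u).
  have [//|c c0 cE] := IH (fun j => g (lift ord0 j)) f _ lf hf'.
  exists (fun i => if unlift ord0 i is Some j then c j else 0).
    by move=> i; case: unliftP.
  move=> u Mu; rewrite big_ord_recl unlift_none mul0r add0r cE //.
  by apply: eq_bigr => j _; rewrite liftK.
move=> /existsNP[x /not_implyP[Mx /not_implyP[gx /negP]]].
rewrite -ltNge => fx.
have g0x : g ord0 x < 0.
  rewrite ltNge; apply/negP => g0x; move: fx; rewrite ltNge => /negP; apply.
  by apply: hf => // j; case: (unliftP ord0 j) => [i|] ->.
(* The oblique projection along [x] onto the kernel of [g ord0]. *)
pose P u := - (g ord0 u / g ord0 x) *: x + u.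
have MP u : M u -> M (P u) by exact: linM.
have gPE h u : scalar h -> h (P u) = h u - g ord0 u / g ord0 x * h x.
  by move=> lh; rewrite lh mulNr addrC.
have lP h : scalar h -> scalar (h \o P).
  by move=> lh a u v /=; rewrite !gPE // lh (lg ord0); ring.
have [|||c c0 cE] := IH (fun j => g (lift ord0 j) \o P) (f \o P).
- by move=> j; apply: lP.
- exact: lP.
- move=> u Mu gP; apply: hf; first exact: MP.
  move=> j; case: (unliftP ord0 j) => [i|] ->; first exact: gP.
  by rewrite gPE // divfK ?subrr // lt_eqF.
pose S := \sum_j c j * g (lift ord0 j) x.
(* Expanding the identity for [f \o P] forces the coefficient of [g ord0]; it is nonnegative since
   [f x < 0 <= S] and [g ord0 x < 0]. *)
exists (fun i => if unlift ord0 i is Some j then c j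
                 else (f x - S) / g ord0 x).
  move=> i; case: unliftP => // _.
  rewrite mulr_le0 // ?invr_le0; last exact: ltW.
  rewrite subr_le0 (le_trans (ltW fx)) // sumr_ge0 // => j _.
  exact: mulr_ge0.
move=> u Mu; have := cE u Mu; rewrite /= gPE // => /eqP.
rewrite subr_eq => /eqP ->; rewrite big_ord_recl unlift_none.
under eq_bigr => j _ do rewrite gPE // mulrBr.
rewrite sumrB; under [in RHS]eq_bigr => j _ do rewrite liftK.
have -> : \sum_(j < m) c j * (g ord0 u / g ord0 x * g (lift ord0 j) x) =
    g ord0 u / g ord0 x * S.
  by rewrite mulr_sumr; apply: eq_bigr => j _; ring.
ring.
Qed.

(** * Affine subspaces and relative interiors *)

Lemma affine_direction (R : realType) (V : lmodType R) (L : set V) (x0 : V)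
    (a : R) (u v : V) :
  affine L -> L x0 -> L (x0 + u) -> L (x0 + v) -> L (x0 + (a *: u + v)).
Proof.
move=> aL L0 Lu Lv.
have scal t w : L (x0 + w) -> L (x0 + t *: w).
  move=> Lw; have := aL _ _ t L0 Lw.
  by rewrite scalerDr addrA -scalerDl subrK scale1r.
(* The target is the midpoint of [x0 + (2 * a) *: u] and [x0 + 2 *: v]. *)
have := aL _ _ 2^-1 (scal (2 * a) u Lu) (scal 2 v Lv).
rewrite !scalerDr !scalerA addrACA -scalerDl subrK scale1r.
have -> : (1 - 2^-1) * (2 * a) = a by field.
by rewrite mulVf ?pnatr_eq0 // scale1r.
Qed.

(** These points lie on the line through [W] and [Z], hence in the affine hull, and tend to [W] as
    [e] tends to 0 from the right. *)
Lemma relint_extend (R : realType) (N : nat) (F : set 'M[R]_N)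
    (W Z : 'M[R]_N) :
  relint F W -> F Z ->
  exists2 e : R, 0 < e & F ((1 + e) *: W - e *: Z).
Proof.
move=> [FW nW] FZ.
have hull e : affine_hull F ((1 + e) *: W - e *: Z).
  move=> B [aB FB]; have := aB _ _ (- e) (FB _ FW) (FB _ FZ).
  by rewrite opprK scaleNr.
have cv : (1 + e) *: W - e *: Z @[e --> (0 : R)^'+] --> W.
  suff : (1 + e) *: W - e *: Z @[e --> (0 : R)^'+] -->
      (1 + 0) *: W - 0 *: Z.
    by rewrite addr0 scale1r scale0r subr0.
  have c0 : e @[e --> (0 : R)^'+] --> (0 : R).
    exact/cvg_at_right_filter/cvg_id.
  apply: cvgB; apply: cvgZr_tmp => //.
  by apply: cvgD => //; exact: cvg_cst.
have near0 : \forall e \near (0 : R)^'+, F ((1 + e) *: W - e *: Z).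
  have nF : \forall e \near (0 : R)^'+,
      affine_hull F ((1 + e) *: W - e *: Z) -> F ((1 + e) *: W - e *: Z).
    exact: cv nW.
  by apply: filterS nF => e; apply.
have [e [e0 Fe]] := @filter_ex _ ((0 : R)^'+) _ _
  (filterI (@nbhs_right_gt R 0) near0).
by exists e.
Qed.

Lemma psdmx_symm (R : realType) (N : nat) (X : 'M[R]_N) : psdmx X -> symmx X.
Proof. by case. Qed.

(** * Conic combinations of the [G i] orthogonal to [L] *)

Lemma cone_range (R : realType) (V : lmodType R) (p : nat) (G : 'I_p -> V)
    (c : 'I_p -> R) :
  (forall i, 0 <= c i) -> cone (range G) (\sum_i c i *: G i).
Proof. by move=> c0; exists p, c, G; split=> // i; split=> //; exists i. Qed.

Lemma symmx_sum (R : realType) (N p : nat) (c : 'I_p -> R)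
    (G : 'I_p -> 'M[R]_N) :
  (forall i, symmx (G i)) -> symmx (\sum_i c i *: G i).
Proof.
move=> sG; apply/symmxP; rewrite raddf_sum; apply: eq_bigr => i _.
by rewrite /= linearZ /=; move/symmxP: (sG i) => ->.
Qed.

(* Farkas is applied on the linear span [M] of [L]: adding a large multiple of
   the psd point [X0] moves an element of [M] on which every [G j] is
   nonnegative into the cone over [L], so [G i] vanishes on it too. *)
Lemma orth_positive_coef (R : realType) (N : nat) (L : set 'M[R]_N)
    (X0 : 'M[R]_N) (p : nat) (G : 'I_p -> 'M[R]_N) (i : 'I_p) :
  L `<=` @symmx R N -> affine L -> L X0 -> psdmx X0 ->
  (forall j, psdmx (G j)) ->
  (forall Y, L Y -> (forall j, 0 <= mxinner (G j) Y) -> mxinner (G i) Y = 0) ->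
  exists2 c : 'I_p -> R, forall j, 0 <= c j &
    orthmx L (\sum_j c j *: G j + G i).
Proof.
move=> sL aL LX0 pX0 pG Gi.
(* [M] is the direction space of [L] plus the line through [X0]. *)
pose M := [set Y | exists s, L (X0 + (s *: X0 + Y))].
have [||||u [s Ls] gu|c c0 cE] :=
  @farkas R _ M p (fun j => mxinner (G j)) (fun Y => - mxinner (G i) Y).
- by exists 0; rewrite scale0r !addr0.
- move=> a u v [s Lu] [t Lv]; exists (a * s + t).
  have := affine_direction R _ L X0 a _ _ aL LX0 Lu Lv.
  by rewrite scalerDr scalerA addrACA scalerDl.
- by move=> j a u v; rewrite mxinnerDr mxinnerZr.
- by move=> a u v; rewrite mxinnerDr mxinnerZr opprD mulrN.
(* This [t] makes [1 + t * s] nonnegative, so that [(1 + t * s) *: X0 + t *: u] is a point of [L]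
   with nonnegative inner products with all [G j]. *)
- pose t := (1 + `|s|)^-1.
  have t0 : 0 < t by rewrite invr_gt0 ltr_wpDr.
  have ts : 0 <= 1 + t * s.
    have e : t * (1 + `|s|) = 1 by rewrite mulVf // gt_eqF // ltr_wpDr.
    have := ler_normr s; have := lerNnormlW (lexx `|s|); nra.
  have := affine_direction R _ L X0 t _ 0 aL LX0 Ls.
  rewrite !addr0 => /(_ LX0) LY.
  have E j : mxinner (G j) (X0 + t *: (s *: X0 + u)) =
      (1 + t * s) * mxinner (G j) X0 + t * mxinner (G j) u.
    by rewrite !(mxinnerDr, mxinnerZr); ring.
  have X0ge j : 0 <= mxinner (G j) X0 by exact: mxinner_psd_ge0.
  have := Gi _ LY; rewrite E => GY.
  have {}GY : (1 + t * s) * mxinner (G i) X0 + t * mxinner (G i) u = 0.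
    apply: GY => j; rewrite E; apply: addr_ge0; apply: mulr_ge0 => //.
    exact: ltW.
  have := mulr_ge0 ts (X0ge i); nra.
exists c => //; split.
  apply/symmxP; rewrite linearD /=.
  have /symmxP -> := psdmx_symm R N _ (pG i).
  by have /symmxP -> := symmx_sum R N p c G (fun j => psdmx_symm R N _ (pG j)).
move=> X LX; rewrite mxinnerDl mxinner_suml.
under eq_bigr => j _ do rewrite mxinnerZl.
(* [L] lies in [M]: the choice [s = -1] cancels the base point [X0]. *)
rewrite -cE ?addNr //; exists (-1).
by rewrite scaleN1r addNKr.
Qed.

Theorem proposition2 (R : realType) (N : nat) (L : set 'M[R]_N)
    (L_sym : L `<=` @symmx R N) (L_affine : affine L)
    (L_meets_psd : L `&` @psdmx R N !=set0)
    (p : nat) (G : 'I_p -> 'M[R]_N)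
    (G_psd : forall i, psdmx (G i)) (G_neq0 : forall i, G i != 0)
    (W : 'M[R]_N) :
  let K := cone (range G) in
  let Kstar := [set Y : 'M[R]_N | symmx Y /\ forall i, 0 <= mxinner (G i) Y] in
  let J := [set i : 'I_p | forall Y, (L `&` Kstar) Y -> mxinner (G i) Y = 0] in
  relint (orthmx L `&` K) W ->
  @psdmx R N `&` orthmx [set W] =
  [set Y | psdmx Y /\ forall i, J i -> Y *m G i = 0].
Proof.
move=> K Kstar J riW; have [[oW [k [c [a [ca WE]]]]] _] := riW.
have [X0 [LX0 pX0]] := L_meets_psd.
apply/seteqP; split=> Y /= [pY].
  move=> [sY YW]; split=> // i Ji.
  have [|d d0 [sZ oZ]] :=
    orth_positive_coef R N L X0 p G i L_sym L_affine LX0 pX0 G_psd.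
    by move=> Y' LY' Y'ge; apply: Ji; split=> //; split=> //; exact: L_sym.
  set Z := _ + _ in sZ oZ.
  have KZ : K Z.
    have -> : Z = \sum_j (d j + (j == i)%:R) *: G j.
      under eq_bigr => j _ do rewrite scalerDl.
      rewrite big_split /= /Z; congr (_ + _).
      rewrite (bigD1 i) //= eqxx scale1r big1 ?addr0 // => j /negbTE ->.
      by rewrite scale0r.
    by apply: cone_range => j; rewrite addr_ge0.
  (* Prolonging the segment from [Z] past [W] stays in [K]. As [<W, Y> = 0], this gives
     [<Z, Y> <= 0], whereas [<Z, Y> >= <G i, Y> >= 0]. *)
  have [e e0 [_ [k' [c' [a' [ca' E]]]]]] :=
    relint_extend R N _ W Z riW (conj (conj sZ oZ) KZ).
  have ge0 : 0 <= mxinner ((1 + e) *: W - e *: Z) Y.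
    rewrite E mxinner_suml sumr_ge0 // => j _; rewrite mxinnerZl.
    have [cj [l _ <-]] := ca' j; apply: mulr_ge0 => //.
    exact: mxinner_psd_ge0.
  have WY : mxinner W Y = 0 by rewrite mxinnerC; exact: YW.
  move: ge0; rewrite mxinnerDl -scaleNr !mxinnerZl WY mulr0 add0r mulNr.
  rewrite oppr_ge0 pmulr_rle0 // mxinnerDl => ZY.
  apply: mxinner_psd_eq0 => //.
  apply/le_anti; rewrite mxinner_psd_ge0 // andbT (le_trans _ ZY) // lerDr.
  rewrite mxinner_suml sumr_ge0 // => j _; rewrite mxinnerZl mulr_ge0 //.
  exact: mxinner_psd_ge0.
move=> YG; split=> //; split; first by case: pY.
move=> _ ->; rewrite mxinnerC WE mxinner_suml big1 // => j _.
have [cj [l _ al]] := ca j; rewrite mxinnerZl.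
have [->|cj0] := eqVneq (c j) 0; first by rewrite mul0r.
(* The index [l] is in [J]: for [Y'] in [L] and [Kstar], [<W, Y'> = 0] is a sum of nonnegative
   terms, so the term of [G l], whose coefficient is nonzero, vanishes. *)
rewrite -al mxinnerC /mxinner YG ?mxtrace0 ?mulr0 // => Y' [LY' [_ Y'ge]].
have /eqP := oW.2 _ LY'; rewrite WE mxinner_suml psumr_eq0; last first.
  move=> m _; have [cm [n _ <-]] := ca m.
  by rewrite mxinnerZl mulr_ge0.
move=> /allP /(_ j (mem_index_enum j)) /=.
by rewrite mxinnerZl mulf_eq0 (negbTE cj0) al => /eqP.
Qed.
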